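(* The fair VAE objective with fixed latent distribution $p_{\mathcal{N}(0,I)}(z)$ decomposes into a VAUB alignment term and a regularization term on the latent space: $$\min_{q(z|x,d)}\ \min_{p(x|z,d)}\ \mathbb{E}_q\left[-\log\left(\frac{p(x|z,d)}{q(z|x,d)}\, p_{\mathcal{N}(0,I)}(z)\right)\right]$$ $$=\ \min_{q(z|x,d)}\left\{\left(\min_{p(x|z,d)}\ \min_{p(z)}\ \mathbb{E}_q\left[-\log\left(\frac{p(x|z,d)}{q(z|x,d)}\, p(z)\right)\right]\right)+\mathrm{KL}\big(q(z),p_{\mathcal{N}(0,I)}(z)\big)\right\},$$ where the inner minimum over $p(z)$ is over all densities on the latent space.
   Context: Let $x$ be an observed continuous random vector and $d\in\{1,\dots,k\}$ a domain label with fixed joint data distribution $q(x,d)$. An encoder $q(z|x,d)$ is a conditional density of a latent vector $z$; $q(x,d,z)=q(x,d)q(z|x,d)$, $\mathbb{E}_q$ is expectation under this joint distribution, and $q(z)$ is its marginal density of $z$. A decoder $p(x|z,d)$ is a conditional density of $x$ given $(z,d)$. $p_{\mathcal{N}(0,I)}(z)$ is the standard normal density on the latent space, and $\mathrm{KL}(p,q)=\mathbb{E}_p[\log(p/q)]$. On both sides the encoder and decoder range over the same given classes. All expectations appearing are understood to be well-defined and finite, and the minima are understood to be attained. *)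

(* Defs.v *)
From HB Require Import structures.
From mathcomp Require Import all_boot all_order all_algebra.
From mathcomp Require Import all_classical all_reals all_analysis.

Set Implicit Arguments.
Unset Strict Implicit.
Unset Printing Implicit Defensive.

Import Order.TTheory GRing.Theory Num.Theory.
Import numFieldNormedType.Exports.

Local Open Scope classical_set_scope.
Local Open Scope ring_scope.
Local Open Scope ereal_scope.

(* Lebesgue measure on R^n, carried by [n.-tuple R] with its product           *)
(* sigma-algebra, built as lambda^(n+1) = (lambda \x lambda^n) transported     *)
(* along (x, v) |-> x :: v.                                                    *)
Section lebesgue_cons.
Context (R : realType) (n : nat).
Variable mu : {sigma_finite_measure set (n.-tuple R) -> \bar R}.

Definition tuple_cons (p : measurableTypeR R * n.-tuple R) : n.+1.-tuple R :=
  [tuple of p.1 :: p.2].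

Lemma measurable_tuple_cons : measurable_fun setT tuple_cons.
Proof. exact: measurable_cons. Qed.

Definition lebesgue_cons : set (n.+1.-tuple R) -> \bar R :=
  pushforward (lebesgue_measure \x mu) tuple_cons.

Let lebesgue_cons0 : lebesgue_cons set0 = 0.
Proof. by rewrite /lebesgue_cons /pushforward preimage_set0 measure0. Qed.

Let lebesgue_cons_ge0 A : 0 <= lebesgue_cons A.
Proof. by rewrite /lebesgue_cons /pushforward; exact: measure_ge0. Qed.

Let lebesgue_cons_sigma_additive : semi_sigma_additive lebesgue_cons.
Proof.
exact: (@measure_semi_sigma_additive _ _ _
  (measure_function_pushforward__canonical__measure_function_Measure
    (lebesgue_measure \x mu)%E measurable_tuple_cons)).
Qed.

HB.instance Definition _ := isMeasure.Build _ _ _ lebesgue_cons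
  lebesgue_cons0 lebesgue_cons_ge0 lebesgue_cons_sigma_additive.

Lemma lebesgue_cons_sigma_finite : sigma_finite setT lebesgue_cons.
Proof.
pose un (t : n.+1.-tuple R) : measurableTypeR R * n.-tuple R := (thead t, [tuple of behead t]).
have mun : measurable_fun setT un.
  apply: measurable_fun_pair.
    exact: measurable_tnth.
  exact: measurable_behead.
have unK p : un (tuple_cons p) = p.
  case: p => x v; congr pair; exact: val_inj.
have /sigma_finiteP[F [FT ndF Foo]] := sigma_finiteT (@lebesgue_measure R).
have /sigma_finiteP[G [GT ndG Goo]] := sigma_finiteT mu.
exists (fun i => un @^-1` (F i `*` G i)).
  rewrite -preimage_bigcup; apply/seteqP; split=> // t _ /=.
  have [[i _ Fi] [j _ Gj]] : (\bigcup_k F k) (un t).1 /\ (\bigcup_k G k) (un t).2.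
    by rewrite -FT -GT.
  exists (maxn i j) => //; split.
    by move: Fi; exact/subsetPset/ndF/leq_maxl.
  by move: Gj; exact/subsetPset/ndG/leq_maxr.
move=> i; have [mFi Fi] := Foo i; have [mGi Gi] := Goo i.
have mFG : measurable (F i `*` G i) by exact: measurableX.
split; first by rewrite -[X in measurable X]setTI; exact: mun.
rewrite /lebesgue_cons /pushforward.
rewrite (_ : tuple_cons @^-1` _ = F i `*` G i); last first.
  by apply/seteqP; split=> p; rewrite /preimage /mkset unK.
by rewrite product_measure1E// lte_mul_pinfty// ge0_fin_numE.
Qed.

HB.instance Definition _ := @Measure_isSigmaFinite.Build _ _ _
  lebesgue_cons lebesgue_cons_sigma_finite.

End lebesgue_cons.

Fixpoint lebesgue_tuple (R : realType) (n : nat) :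
    {sigma_finite_measure set (n.-tuple R) -> \bar R} :=
  if n is n'.+1 then lebesgue_cons (lebesgue_tuple R n')
  else \d_([tuple] : 0.-tuple R).

Definition std_normal_pdf (R : realType) (n : nat) (z : n.-tuple R) : R :=
  (\prod_(i < n) normal_pdf 0 1 (tnth z i))%R.

Definition is_density (R : realType) (n : nat) (p : n.-tuple R -> R) :=
  [/\ measurable_fun setT p,
      forall z, (0 <= p z)%R &
      \int[lebesgue_tuple R n]_z (p z)%:E = 1].

(* Densities on 'I_k * R^m w.r.t. counting measure times Lebesgue measure.     *)
Definition is_data_density (R : realType) (k m : nat)
    (q : 'I_k -> m.-tuple R -> R) :=
  [/\ forall d, measurable_fun setT (q d),
      forall d x, (0 <= q d x)%R &
      \sum_(d < k) \int[lebesgue_tuple R m]_x (q d x)%:E = 1].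

(* [f d u] is the density of v given (u, d).                                   *)
Definition cond_fun (R : realType) (k a b : nat) :=
  'I_k -> a.-tuple R -> b.-tuple R -> R.

Definition is_cond_density (R : realType) (k a b : nat)
    (f : cond_fun R k a b) :=
  (forall d, measurable_fun setT
     (fun uv : a.-tuple R * b.-tuple R => f d uv.1 uv.2)) /\
  (forall d u, is_density (f d u)).

Section objectives.
Context (R : realType) (k m n : nat).
Implicit Types (q : 'I_k -> m.-tuple R -> R) (e : cond_fun R k m n)
  (g : cond_fun R k n m) (p : n.-tuple R -> R)
  (F : 'I_k -> m.-tuple R -> n.-tuple R -> \bar R).

Definition joint q e (d : 'I_k) (x : m.-tuple R) (z : n.-tuple R) : R :=
  (q d x * e d x z)%R.

(* Products in \bar R satisfy 0 * +oo = 0, so the values of F outside the      *)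
(* support of the joint density are irrelevant.                                *)
Definition expect_integrand q e F (d : 'I_k) (xz : m.-tuple R * n.-tuple R) :
    \bar R :=
  (joint q e d xz.1 xz.2)%:E * F d xz.1 xz.2.

Definition expect q e F : \bar R :=
  \sum_(d < k) \int[lebesgue_tuple R m \x lebesgue_tuple R n]_xz
    expect_integrand q e F d xz.

Definition expect_finite q e F : Prop :=
  forall d, (lebesgue_tuple R m \x lebesgue_tuple R n).-integrable setT
    (expect_integrand q e F d).

(* The sum is finite for almost every z only; [fine] sends +oo to 0 on the     *)
(* remaining null set.                                                         *)
Definition marginal q e (z : n.-tuple R) : R :=
  fine (\sum_(d < k) \int[lebesgue_tuple R m]_x (joint q e d x z)%:E).

(* The extended logarithm [lne] satisfies lne 0 = -oo, whereas ln 0 = 0.       *)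
Definition neg_log_ratio e g p (d : 'I_k) (x : m.-tuple R) (z : n.-tuple R) :
    \bar R :=
  - lne ((g d z x)%:E / (e d x z)%:E * (p z)%:E).

Definition vae_objective q e g p : \bar R := expect q e (neg_log_ratio e g p).

End objectives.

Definition KL_integrand (R : realType) (n : nat) (p1 p2 : n.-tuple R -> R)
    (z : n.-tuple R) : \bar R :=
  (p1 z)%:E * lne ((p1 z)%:E / (p2 z)%:E).

Definition KL (R : realType) (n : nat) (p1 p2 : n.-tuple R -> R) : \bar R :=
  \int[lebesgue_tuple R n]_z KL_integrand p1 p2 z.

Definition KL_finite (R : realType) (n : nat) (p1 p2 : n.-tuple R -> R) : Prop :=
  (lebesgue_tuple R n).-integrable setT (KL_integrand p1 p2).

(* [emin D f] is the minimum of f over D whenever [attains_min D f] holds.     *)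
Definition emin (R : realType) (T : Type) (D : set T) (f : T -> \bar R) :
    \bar R :=
  ereal_inf (f @` D).

Definition attains_min (R : realType) (T : Type) (D : set T) (f : T -> \bar R) :
    Prop :=
  exists2 t, D t & forall s, D s -> f t <= f s.

(* Main.v *)
Require Import Defs.
From HB Require Import structures.
From mathcomp Require Import all_boot all_order all_algebra.
From mathcomp Require Import all_classical all_reals all_analysis.
From mathcomp Require Import ring.
From mathcomp Require Import measurable_realfun.
Import Order.TTheory GRing.Theory Num.Theory.
Import numFieldNormedType.Exports.
Local Open Scope classical_set_scope.
Local Open Scope ring_scope.
Local Open Scope ereal_scope.

(* For fixed e and g, let F p be the objective as a function of the latent
   density p, phi the standard normal density and r the marginal of z. Functions
   of z alone integrate against the joint density as they do against r (Tonelli),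
   so integrating
     - log (g / e * r) = - log (g / e * phi) - log (r / phi)
   gives F r = F phi - KL(r, phi). Gibbs' inequality, from
   log (p / r) <= p / r - 1 and \int r (p / r - 1) <= 0, shows that r minimizes F
   over all densities. So the inner minimum over p is F phi - KL(r, phi), and the
   KL term, which depends neither on g nor on p, cancels. *)

(** * Measurability and integration preliminaries *)

(* Extracting the square leaves a nonnegative base, where [`^ (-1)] is the
   inverse; at 0 both sides are 0. *)
Lemma measurable_invr (R : realType) : measurable_fun [set: R] (@GRing.inv R).
Proof.
have -> : @GRing.inv R = (fun x => x * (x ^+ 2) `^ (-1))%R.
  apply/funext => x; rewrite powR_inv1 ?sqr_ge0//.
  have [->|x0] := eqVneq x 0%R; first by rewrite invr0 mul0r.
  by rewrite expr2 invfM mulrA divff// mul1r.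
apply: measurable_funM => //.
by apply: (measurableT_comp
  (f := fun y : R => y `^ (-1)) (g := fun x : R => x ^+ 2)%R).
Qed.

Lemma measurable_funV (d : measure_display) (T : measurableType d)
    (R : realType) (f : T -> R) :
  measurable_fun setT f -> measurable_fun setT (fun x => (f x)^-1)%R.
Proof. by move=> mf; exact: (measurableT_comp (measurable_invr R)). Qed.

Lemma measurable_lne_EFin (R : realType) :
  measurable_fun [set: R] (fun x : R => lne x%:E).
Proof.
rewrite /lne; apply: measurable_fun_ifT => //.
  exact: measurable_fun_ler.
by apply/measurable_EFinP; exact: measurable_ln.
Qed.

(* [f2] need not be integrable. The integrable minorant [f1] bounds its negative
   part, which excludes the junk value [+oo - +oo = -oo]. *)
Lemma ae_le_integral_of_integrable (d : measure_display)
    (T : measurableType d) (R : realType) (mu : {measure set T -> \bar R})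
    (f1 f2 : T -> \bar R) :
  mu.-integrable setT f1 -> measurable_fun setT f2 ->
  {ae mu, forall x, f1 x <= f2 x} ->
  \int[mu]_x f1 x <= \int[mu]_x f2 x.
Proof.
move=> if1 mf2 le12; rewrite integralE [leRHS]integralE.
have mf1 := measurable_int _ if1.
apply: leeB; apply: ae_ge0_le_integral => //.
- exact: measurable_funepos.
- exact: measurable_funepos.
- apply: filterS le12 => x le12 _.
  by rewrite !funeposE ge_max !le_max le12 lexx orbT.
- exact: measurable_funeneg.
- exact: measurable_funeneg.
- apply: filterS le12 => x le12 _.
  by rewrite !funenegE ge_max !le_max leeN2 le12 lexx orbT.
Qed.

Lemma ae_eq_integrable (d : measure_display) (T : measurableType d)
    (R : realType) (mu : {measure set T -> \bar R}) (f1 f2 : T -> \bar R) :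
  measurable_fun setT f2 -> ae_eq mu setT f1 f2 ->
  mu.-integrable setT f1 -> mu.-integrable setT f2.
Proof.
move=> mf2 f12 /integrableP[mf1 f1oo]; apply/integrableP; split => //.
rewrite [ltLHS](_ : _ = \int[mu]_x `|f1 x|)//; apply: ae_eq_integral => //.
- exact: measurableT_comp.
- exact: measurableT_comp.
- by apply: ae_eq_abse; exact: ae_eq_sym.
Qed.

(** * The standard normal density and pointwise logarithm estimates *)

Lemma std_normal_pdf_gt0 (R : realType) (n : nat) (z : n.-tuple R) :
  (0 < std_normal_pdf z)%R.
Proof.
apply: prodr_gt0 => i _; rewrite normal_pdfE ?oner_eq0//.
by rewrite mulr_gt0 ?normal_peak_gt0 ?oner_eq0 ?expR_gt0.
Qed.

Lemma measurable_std_normal_pdf (R : realType) (n : nat) :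
  measurable_fun setT (@std_normal_pdf R n).
Proof.
apply: measurable_prod => i _; apply: measurableT_comp.
  exact: measurable_normal_pdf.
exact: measurable_tnth.
Qed.

(** Weighted form of log (t a) = log (t b) + log (a / b). A vanishing decoder gives [t] = 0: then
    both sides are +oo, because [j] is positive and the subtracted term is finite. *)
Lemma mule_oppe_lneM (R : realType) (j t a b : R) :
  (0 < j)%R -> (0 <= t)%R -> (0 < a)%R -> (0 < b)%R ->
  j%:E * - lne (t%:E * a%:E) =
  j%:E * - lne (t%:E * b%:E) - (j * ln (a / b))%:E.
Proof.
move=> j0 t0 a0 b0; have NNy : - -oo = +oo :> \bar R by [].
have [->|tn0] := eqVneq t 0%R.
  by rewrite !mul0e /= lexx NNy gt0_muley ?lte_fin.
have tpos : (0 < t)%R by rewrite lt_neqAle eq_sym tn0.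
rewrite -!EFinM !lne_EFin ?mulr_gt0//= -!EFinM -EFinB; congr EFin.
by rewrite ln_div ?posrE// !lnM ?posrE//; ring.
Qed.

(** Pointwise Gibbs inequality, from log (p / a) <= p / a - 1. At [p] = 0 the right-hand side is
    +oo; for positive [p] the change of density from [a] to [p] is exact. *)
Lemma mule_oppe_lne_le (R : realType) (j t a p : R) :
  (0 < j)%R -> (0 <= t)%R -> (0 < a)%R -> (0 <= p)%R ->
  j%:E * - lne (t%:E * a%:E) - (j * (p / a - 1))%:E <=
  j%:E * - lne (t%:E * p%:E).
Proof.
move=> j0 t0 a0; have NNy : - -oo = +oo :> \bar R by [].
rewrite le_eqVlt => /predU1P[<-|p0].
  by rewrite mule0 /= lexx NNy gt0_muley ?lte_fin// leey.
rewrite (mule_oppe_lneM _ j t p a)//; apply: leeB => //.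
rewrite lee_fin ler_pM2l//.
(* This is ln (1 + y) <= y at y = p / a - 1, which exceeds -1 since p / a is positive. *)
have := @le_ln1Dx R (p / a - 1)%R; rewrite addrCA subrr addr0; apply.
by rewrite ltrBrDr addrC subrr divr_gt0.
Qed.

(** * The joint density and its latent marginal *)

Lemma joint_ge0 (R : realType) (k m n : nat) (q : 'I_k -> m.-tuple R -> R)
    (e : cond_fun R k m n) (d : 'I_k) (x : m.-tuple R) (z : n.-tuple R) :
  is_data_density q -> is_cond_density e -> (0 <= joint q e d x z)%R.
Proof. by move=> [_ q0 _] [_ /(_ d x)[_ e0 _]]; exact: mulr_ge0. Qed.

Lemma measurable_joint (R : realType) (k m n : nat)
    (q : 'I_k -> m.-tuple R -> R) (e : cond_fun R k m n) (d : 'I_k) :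
  is_data_density q -> is_cond_density e ->
  measurable_fun setT
    (fun xz : m.-tuple R * n.-tuple R => joint q e d xz.1 xz.2).
Proof.
move=> [mq _ _] [me _]; apply: measurable_funM; last exact: me.
exact: (measurableT_comp (mq d)).
Qed.

Lemma measurable_joint_integral (R : realType) (k m n : nat)
    (q : 'I_k -> m.-tuple R -> R) (e : cond_fun R k m n) (d : 'I_k) :
  is_data_density q -> is_cond_density e ->
  measurable_fun setT
    (fun z => \int[lebesgue_tuple R m]_x (joint q e d x z)%:E).
Proof.
move=> qd ed; apply: (measurable_fun_fubini_tonelli_G (m1 := lebesgue_tuple R m)
  (fun xz => (joint q e d xz.1 xz.2)%:E)) => [|xz].
  by apply/measurable_EFinP; exact: measurable_joint.
by rewrite lee_fin joint_ge0.
Qed.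

Lemma joint_integral_ge0 (R : realType) (k m n : nat)
    (q : 'I_k -> m.-tuple R -> R) (e : cond_fun R k m n) (d : 'I_k)
    (z : n.-tuple R) :
  is_data_density q -> is_cond_density e ->
  0 <= \int[lebesgue_tuple R m]_x (joint q e d x z)%:E.
Proof.
by move=> qd ed; apply: integral_ge0 => x _; rewrite lee_fin joint_ge0.
Qed.

Lemma marginal_ge0 (R : realType) (k m n : nat) (q : 'I_k -> m.-tuple R -> R)
    (e : cond_fun R k m n) (z : n.-tuple R) :
  is_data_density q -> is_cond_density e -> (0 <= marginal q e z)%R.
Proof.
by move=> qd ed; apply/fine_ge0/sume_ge0 => d _; exact: joint_integral_ge0.
Qed.

Lemma measurable_marginal (R : realType) (k m n : nat)
    (q : 'I_k -> m.-tuple R -> R) (e : cond_fun R k m n) :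
  is_data_density q -> is_cond_density e ->
  measurable_fun setT (marginal q e).
Proof.
move=> qd ed; apply: measurableT_comp; first exact: fine_measurable.
by apply: emeasurable_sum => d; exact: measurable_joint_integral.
Qed.

(** By Tonelli the integral over z can be taken first; the encoder then contributes 1 and the total
    mass of [q] remains. *)
Lemma integral_joint (R : realType) (k m n : nat)
    (q : 'I_k -> m.-tuple R -> R) (e : cond_fun R k m n) :
  is_data_density q -> is_cond_density e ->
  \int[lebesgue_tuple R n]_z
    (\sum_(d < k) \int[lebesgue_tuple R m]_x (joint q e d x z)%:E) = 1.
Proof.
move=> qd ed; have [mq q0 <-] := qd; have [me ed'] := ed.
rewrite ge0_integral_sum//; last 2 first.
  by move=> d; exact: measurable_joint_integral.
  by move=> d z _; exact: joint_integral_ge0.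
apply: eq_bigr => d _.
have mj : measurable_fun setT
    (fun xz : m.-tuple R * n.-tuple R => (joint q e d xz.1 xz.2)%:E).
  by apply/measurable_EFinP; exact: measurable_joint.
have j0 (xz : m.-tuple R * n.-tuple R) : 0 <= (joint q e d xz.1 xz.2)%:E.
  by rewrite lee_fin joint_ge0.
transitivity (\int[lebesgue_tuple R m \x lebesgue_tuple R n]_xz
    (joint q e d xz.1 xz.2)%:E).
  by rewrite fubini_tonelli2.
rewrite fubini_tonelli1//; apply: eq_integral => x _; rewrite /fubini_F/=.
have [mex e0 e1] := ed' d x.
under eq_integral do rewrite EFinM.
rewrite ge0_integralZl//.
- by rewrite e1 mule1.
- exact/measurable_EFinP.
- by move=> z _; rewrite lee_fin.
- by rewrite lee_fin.
Qed.

(** The sum has integral 1, so it is finite almost everywhere, and there [fine] loses nothing. *)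
Lemma marginalE_ae (R : realType) (k m n : nat) (q : 'I_k -> m.-tuple R -> R)
    (e : cond_fun R k m n) :
  is_data_density q -> is_cond_density e ->
  {ae lebesgue_tuple R n, forall z, (marginal q e z)%:E =
    \sum_(d < k) \int[lebesgue_tuple R m]_x (joint q e d x z)%:E}.
Proof.
move=> qd ed; have s0 z :
    0 <= \sum_(d < k) \int[lebesgue_tuple R m]_x (joint q e d x z)%:E.
  by apply: sume_ge0 => d _; exact: joint_integral_ge0.
have si : (lebesgue_tuple R n).-integrable setT (fun z =>
    \sum_(d < k) \int[lebesgue_tuple R m]_x (joint q e d x z)%:E).
  apply/integrableP; split.
    by apply: emeasurable_sum => d; exact: measurable_joint_integral.
  under eq_integral do rewrite gee0_abs//.
  by rewrite integral_joint// ltry.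
by apply: filterS (integrable_ae measurableT si) => z /(_ I) zfin; rewrite fineK.
Qed.

Lemma marginal_density (R : realType) (k m n : nat)
    (q : 'I_k -> m.-tuple R -> R) (e : cond_fun R k m n) :
  is_data_density q -> is_cond_density e -> is_density (marginal q e).
Proof.
move=> qd ed; split; first exact: measurable_marginal.
  by move=> z; exact: marginal_ge0.
rewrite -(integral_joint R k m n q e qd ed); apply: ae_eq_integral => //.
- by apply/measurable_EFinP; exact: measurable_marginal.
- by apply: emeasurable_sum => d; exact: measurable_joint_integral.
- by apply: filterS (marginalE_ae R k m n q e qd ed) => z zE _.
Qed.

(** * Expectations of functions of the latent variable *)

Lemma ge0_expect_latent (R : realType) (k m n : nat)
    (q : 'I_k -> m.-tuple R -> R) (e : cond_fun R k m n) (h : n.-tuple R -> R) :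
  is_data_density q -> is_cond_density e ->
  measurable_fun setT h -> (forall z, 0 <= h z)%R ->
  expect q e (fun _ _ z => (h z)%:E) =
  \int[lebesgue_tuple R n]_z (marginal q e z * h z)%:E.
Proof.
move=> qd ed mh h0.
transitivity (\int[lebesgue_tuple R n]_z
    \sum_(d < k) \int[lebesgue_tuple R m]_x (joint q e d x z)%:E * (h z)%:E).
  rewrite ge0_integral_sum//; last 2 first.
    move=> d; apply: emeasurable_funM; first exact: measurable_joint_integral.
    exact/measurable_EFinP.
    by move=> d z _; rewrite mule_ge0 ?joint_integral_ge0// lee_fin.
  (* With x integrated first, [h z] is a constant that leaves the inner integral. *)
  apply: eq_bigr => d _; rewrite fubini_tonelli2/=; last 2 first.
    apply: emeasurable_funM.
      by apply/measurable_EFinP; exact: measurable_joint.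
    by apply/measurable_EFinP; exact: (measurableT_comp mh).
    by move=> xz; rewrite mule_ge0 ?lee_fin ?joint_ge0.
  apply: eq_integral => z _; rewrite /fubini_G /expect_integrand/=.
  rewrite ge0_integralZr ?lee_fin//.
    apply/measurable_EFinP.
    apply: (measurable_fun_pair1 (f := fun xz => joint q e d xz.1 xz.2)).
    exact: measurable_joint.
  by move=> x _; rewrite lee_fin joint_ge0.
(* The sum of inner integrals is the marginal only off a null set. *)
apply: ae_eq_integral => //.
- apply: emeasurable_sum => d; apply: emeasurable_funM.
    exact: measurable_joint_integral.
  exact/measurable_EFinP.
- apply/measurable_EFinP; apply: measurable_funM => //.
  exact: measurable_marginal.
- apply: filterS (marginalE_ae R k m n q e qd ed) => z zE _.
  by rewrite EFinM zE ge0_sume_distrl// => d _; exact: joint_integral_ge0.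
Qed.

Lemma ge0_integral_le_expect (R : realType) (k m n : nat)
    (q : 'I_k -> m.-tuple R -> R) (e : cond_fun R k m n)
    (F : 'I_k -> m.-tuple R -> n.-tuple R -> \bar R) (d : 'I_k) :
  is_data_density q -> is_cond_density e -> (forall d x z, 0 <= F d x z) ->
  \int[lebesgue_tuple R m \x lebesgue_tuple R n]_xz
    expect_integrand q e F d xz <= expect q e F.
Proof.
move=> qd ed F0; rewrite /expect [leRHS](bigD1 d)//= leeDl// sume_ge0// => d' _.
apply: integral_ge0 => xz _.
by rewrite mule_ge0 ?lee_fin ?joint_ge0.
Qed.

(** The nonnegative case applied to |h| bounds the sum over all labels, and each label's share is at
    most that sum. *)
Lemma expect_finite_latent (R : realType) (k m n : nat)
    (q : 'I_k -> m.-tuple R -> R) (e : cond_fun R k m n) (h : n.-tuple R -> R) :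
  is_data_density q -> is_cond_density e -> measurable_fun setT h ->
  (lebesgue_tuple R n).-integrable setT
    (fun z => (marginal q e z * h z)%:E) ->
  expect_finite q e (fun _ _ z => (h z)%:E).
Proof.
move=> qd ed mh ih d.
have mI : measurable_fun setT (expect_integrand q e (fun _ _ z => (h z)%:E) d).
  apply: emeasurable_funM.
    by apply/measurable_EFinP; exact: measurable_joint.
  by apply/measurable_EFinP; exact: (measurableT_comp mh).
apply/integrableP; split => //.
have : expect q e (fun _ _ z => (`|h z|%R)%:E) < +oo.
  rewrite ge0_expect_latent//; last exact: measurableT_comp.
  move/integrableP : ih => [_]; apply: le_lt_trans.
  rewrite le_eqVlt; apply/orP; left; apply/eqP; apply: eq_integral => z _.
  by rewrite /= normrM (ger0_norm (marginal_ge0 _ _ _ _ _ _ _ _ _)).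
apply: le_lt_trans.
apply: le_trans (ge0_integral_le_expect _ _ _ _ _ _ _ d qd ed _) => //.
rewrite le_eqVlt; apply/orP; left; apply/eqP; apply: eq_integral => xz _.
by rewrite /= normrM ger0_norm ?joint_ge0.
Qed.

(** In [\bar R] negation need not distribute over a sum with infinite terms of both signs;
    finiteness of the integrals for [G] makes it do so. *)
Lemma expectB (R : realType) (k m n : nat)
    (q : 'I_k -> m.-tuple R -> R) (e : cond_fun R k m n)
    (F G : 'I_k -> m.-tuple R -> n.-tuple R -> \bar R) :
  expect_finite q e F -> expect_finite q e G ->
  \sum_(d < k) \int[lebesgue_tuple R m \x lebesgue_tuple R n]_xz
    (expect_integrand q e F d xz - expect_integrand q e G d xz) =
  expect q e F - expect q e G.
Proof.
move=> iF iG; rewrite /expect.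
have fG d : \int[lebesgue_tuple R m \x lebesgue_tuple R n]_xz
    expect_integrand q e G d xz \is a fin_num.
  exact: integrable_fin_num.
rewrite -fin_num_sumeN// -big_split/=.
by apply: eq_bigr => d _; rewrite integralB.
Qed.

Lemma expect_latent (R : realType) (k m n : nat)
    (q : 'I_k -> m.-tuple R -> R) (e : cond_fun R k m n) (h : n.-tuple R -> R) :
  is_data_density q -> is_cond_density e -> measurable_fun setT h ->
  (lebesgue_tuple R n).-integrable setT
    (fun z => (marginal q e z * h z)%:E) ->
  expect q e (fun _ _ z => (h z)%:E) =
  \int[lebesgue_tuple R n]_z (marginal q e z * h z)%:E.
Proof.
move=> qd ed mh ih.
have mM := measurable_marginal R k m n q e qd ed.
(* Domination by |h| makes the positive and negative parts of [h] integrable against the marginal,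
   so the nonnegative case applies to each and the results may be subtracted. *)
have ile (g : n.-tuple R -> R) : measurable_fun setT g ->
    (forall z, `|g z| <= `|h z|)%R ->
    (lebesgue_tuple R n).-integrable setT
      (fun z => (marginal q e z * g z)%:E).
  move=> mg gh; apply: le_integrable ih => //.
    by apply/measurable_EFinP; exact: measurable_funM.
  by move=> z _ /=; rewrite lee_fin !normrM ler_wpM2l.
have mp : measurable_fun setT h^\+%R by exact: measurable_funrpos.
have mn : measurable_fun setT h^\-%R by exact: measurable_funrneg.
have ip : (lebesgue_tuple R n).-integrable setT
    (fun z => (marginal q e z * h^\+%R z)%:E).
  apply: ile => // z; rewrite ger0_norm ?funrpos_ge0//.
  by rewrite /funrpos ge_max ler_norm normr_ge0.
have iN : (lebesgue_tuple R n).-integrable setT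
    (fun z => (marginal q e z * h^\-%R z)%:E).
  apply: ile => // z; rewrite ger0_norm ?funrneg_ge0//.
  by rewrite /funrneg ge_max ler_normr lexx orbT normr_ge0.
have hE z : (h z = h^\+%R z - h^\-%R z)%R.
  exact: esym (congr1 (fun f => f z) (funrposBneg h)).
transitivity (expect q e (fun _ _ z => (h^\+%R z)%:E) -
              expect q e (fun _ _ z => (h^\-%R z)%:E)).
  rewrite -expectB; [|exact: expect_finite_latent..].
  apply: eq_bigr => d _; apply: eq_integral => xz _.
  by rewrite /expect_integrand -muleBr// -EFinB -hE.
rewrite !ge0_expect_latent//.
rewrite -integralB//; apply: eq_integral => z _.
by rewrite -EFinB -mulrBr -hE.
Qed.

(** This permits dividing by the marginal and taking its logarithm wherever the joint density has
    mass. The test function [h] is the indicator of the zeros of the marginal: its expectation is 0,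
    so the nonnegative integrand joint * h vanishes almost everywhere. *)
Lemma joint_gt0_marginal_ae (R : realType) (k m n : nat)
    (q : 'I_k -> m.-tuple R -> R) (e : cond_fun R k m n) (d : 'I_k) :
  is_data_density q -> is_cond_density e ->
  {ae (lebesgue_tuple R m \x lebesgue_tuple R n), forall xz,
    0 < joint q e d xz.1 xz.2 -> 0 < marginal q e xz.2}%R.
Proof.
move=> qd ed; pose h z : R := if marginal q e z == 0%R then 1%R else 0%R.
have mh : measurable_fun setT h.
  apply: measurable_fun_ifT => //.
  by apply: measurable_fun_eqr => //; exact: measurable_marginal.
have h0 z : (0 <= h z)%R by rewrite /h; case: ifP.
have Mh0 z : (marginal q e z * h z = 0)%R.
  by rewrite /h; have [->|] := eqVneq; rewrite ?mul0r ?mulr0.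
have fin : expect_finite q e (fun _ _ z => (h z)%:E).
  apply: expect_finite_latent => //; under eq_fun do rewrite Mh0.
  exact: integrable0.
have E0 : expect q e (fun _ _ z => (h z)%:E) = 0.
  rewrite ge0_expect_latent//.
  by under eq_integral do rewrite Mh0; exact: integral0.
have I0 xz d' : 0 <= expect_integrand q e (fun _ _ z => (h z)%:E) d' xz.
  by rewrite mule_ge0 ?lee_fin ?joint_ge0.
have Id0 : \int[lebesgue_tuple R m \x lebesgue_tuple R n]_xz
    expect_integrand q e (fun _ _ z => (h z)%:E) d xz = 0.
  apply/eqP; rewrite eq_le integral_ge0// andbT -E0.
  exact: ge0_integral_le_expect.
have /(ae_eq_integral_abs _ measurableT (measurable_int _ (fin d))) :
  \int[lebesgue_tuple R m \x lebesgue_tuple R n]_xz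
    `|expect_integrand q e (fun _ _ z => (h z)%:E) d xz| = 0.
  by under eq_integral do rewrite gee0_abs//.
apply: filterS => xz /(_ I) + j0.
rewrite lt_neqAle marginal_ge0// andbT eq_sym.
rewrite /expect_integrand /h; have [_|//] := eqVneq.
by rewrite mule1 => -[] jE; rewrite jE ltxx in j0.
Qed.

(** * The objective at the marginal compared with other latent densities *)

(** The quotient g / e moves from [\bar R] to [R]. The two quotients can differ only where the
    encoder is 0, and there the joint density, also 0, annihilates the integrand. *)
Lemma expect_integrand_neg_log_ratioE (R : realType) (k m n : nat)
    (q : 'I_k -> m.-tuple R -> R) (e : cond_fun R k m n) (g : cond_fun R k n m)
    (p : n.-tuple R -> R) (d : 'I_k) (xz : m.-tuple R * n.-tuple R) :
  expect_integrand q e (neg_log_ratio e g p) d xz =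
  (joint q e d xz.1 xz.2)%:E *
    - lne ((g d xz.2 xz.1 / e d xz.1 xz.2)%:E * (p xz.2)%:E).
Proof.
rewrite /expect_integrand /neg_log_ratio /joint.
have [->|e0] := eqVneq (e d xz.1 xz.2) 0%R; first by rewrite mulr0 !mul0e.
by rewrite inver (negbTE e0).
Qed.

Lemma measurable_vae_integrand (R : realType) (k m n : nat)
    (q : 'I_k -> m.-tuple R -> R) (e : cond_fun R k m n) (g : cond_fun R k n m)
    (p : n.-tuple R -> R) (d : 'I_k) :
  is_data_density q -> is_cond_density e -> is_cond_density g ->
  measurable_fun setT p ->
  measurable_fun setT (expect_integrand q e (neg_log_ratio e g p) d).
Proof.
move=> qd ed [mg _] mp.
have /funext -> := expect_integrand_neg_log_ratioE R k m n q e g p d.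
apply: emeasurable_funM.
  by apply/measurable_EFinP; exact: measurable_joint.
apply: measurableT_comp => //.
apply: (measurableT_comp (measurable_lne_EFin R)).
apply: measurable_funM; last exact: (measurableT_comp mp).
apply: measurable_funM; last by apply: measurable_funV; exact: ed.1.
exact: (measurableT_comp (mg d) (@measurable_swap _ _ _ _)).
Qed.

Lemma integrable_density (R : realType) (n : nat) (p : n.-tuple R -> R) :
  is_density p -> (lebesgue_tuple R n).-integrable setT (fun z => (p z)%:E).
Proof.
move=> [mp p0 p1]; apply/integrableP; split; first exact/measurable_EFinP.
under eq_integral do rewrite gee0_abs ?lee_fin//.
by rewrite p1 ltry.
Qed.

(** At a zero of [p1] the extended logarithm is -oo, but the factor 0 makes both sides 0. *)
Lemma KL_integrand_ln (R : realType) (n : nat) (p1 p2 : n.-tuple R -> R)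
    (z : n.-tuple R) : (0 <= p1 z)%R -> (0 < p2 z)%R ->
  KL_integrand p1 p2 z = (p1 z * ln (p1 z / p2 z))%:E.
Proof.
move=> p10 p20; rewrite /KL_integrand inver gt_eqF//.
have [->|p1n0] := eqVneq (p1 z) 0%R; first by rewrite mul0e mul0r.
by rewrite -EFinM lne_EFin// divr_gt0// lt_neqAle eq_sym p1n0.
Qed.

Lemma vae_objective_marginal (R : realType) (k m n : nat)
    (q : 'I_k -> m.-tuple R -> R) (e : cond_fun R k m n) (g : cond_fun R k n m)
    (p : n.-tuple R -> R) :
  is_data_density q -> is_cond_density e -> is_cond_density g ->
  measurable_fun setT p -> (forall z, 0 < p z)%R ->
  KL_finite (marginal q e) p ->
  expect_finite q e (neg_log_ratio e g p) ->
  expect_finite q e (neg_log_ratio e g (marginal q e)) /\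
  vae_objective q e g (marginal q e) =
    vae_objective q e g p - KL (marginal q e) p.
Proof.
move=> qd ed gd mp p0 KLfin pfin.
have M0 z : (0 <= marginal q e z)%R by exact: marginal_ge0.
have mM : measurable_fun setT (marginal q e) by exact: measurable_marginal.
pose h z := ln (marginal q e z / p z)%R.
have mh : measurable_fun setT h.
  apply: measurableT_comp => //; apply: measurable_funM => //.
  exact: measurable_funV.
have KLE : KL_integrand (marginal q e) p = (fun z => (marginal q e z * h z)%:E).
  by apply/funext => z; exact: KL_integrand_ln.
have ih : (lebesgue_tuple R n).-integrable setT
    (fun z => (marginal q e z * h z)%:E) by rewrite -KLE.
have hfin := expect_finite_latent R k m n q e h qd ed mh ih.
have mfin d := measurable_vae_integrand R k m n q e g _ d qd ed gd mM.
(* Where the joint density is 0 both integrands are 0; elsewhere the marginal is positive almost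
   everywhere and [mule_oppe_lneM] exchanges [p] for it. *)
have aeE d : ae_eq (lebesgue_tuple R m \x lebesgue_tuple R n) setT
    (fun xz => expect_integrand q e (neg_log_ratio e g p) d xz -
               expect_integrand q e (fun _ _ z => (h z)%:E) d xz)
    (expect_integrand q e (neg_log_ratio e g (marginal q e)) d).
  apply: filterS (joint_gt0_marginal_ae R k m n q e d qd ed) => xz + _.
  rewrite !expect_integrand_neg_log_ratioE /expect_integrand.
  move: xz.1 xz.2 => x z Mgt0.
  have [->|j0] := eqVneq (joint q e d x z) 0%R; first by rewrite !mul0e sube0.
  have jgt0 : (0 < joint q e d x z)%R by rewrite lt_neqAle eq_sym j0 joint_ge0.
  rewrite [RHS](mule_oppe_lneM _ _ _ _ (p z))//.
    by rewrite divr_ge0//; [case: gd => _ /(_ d z)[]|case: ed => _ /(_ d x)[]].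
  exact: Mgt0.
have iB d : (lebesgue_tuple R m \x lebesgue_tuple R n).-integrable setT
    (fun xz => expect_integrand q e (neg_log_ratio e g p) d xz -
               expect_integrand q e (fun _ _ z => (h z)%:E) d xz).
  exact: integrableB.
split.
  by move=> d; exact: ae_eq_integrable (mfin d) (aeE d) (iB d).
rewrite /vae_objective /KL KLE -(expect_latent R k m n q e h)//.
rewrite -expectB//; apply: eq_bigr => d _; apply: ae_eq_integral => //.
  exact: measurable_int (iB d).
exact: ae_eq_sym.
Qed.

(** With r the marginal, F the objective and h = p / r - 1, the chain is F r <= F r - E h <= F p.
    Only the integrand at r is known to be integrable, so the last step compares integrals from an
    integrable minorant instead of subtracting them. *)
Lemma vae_objective_ge_marginal (R : realType) (k m n : nat)
    (q : 'I_k -> m.-tuple R -> R) (e : cond_fun R k m n) (g : cond_fun R k n m)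
    (p : n.-tuple R -> R) :
  is_data_density q -> is_cond_density e -> is_cond_density g ->
  is_density p ->
  expect_finite q e (neg_log_ratio e g (marginal q e)) ->
  vae_objective q e g (marginal q e) <= vae_objective q e g p.
Proof.
move=> qd ed gd pd Mfin; have [mp p0 p1] := pd.
have Md := marginal_density R k m n q e qd ed; have [mM M0 M1] := Md.
pose h z := (p z / marginal q e z - 1)%R.
have mh : measurable_fun setT h.
  by apply: measurable_funB => //; apply: measurable_funM => //;
    exact: measurable_funV.
(* Only an inequality: where the marginal is 0 the real quotient is 0, while [p z] may be
   positive. *)
have Mle z : (marginal q e z * (p z / marginal q e z) <= p z)%R.
  have [->|M_neq0] := eqVneq (marginal q e z) 0%R; first by rewrite mul0r.
  by rewrite mulrC divfK.
have ih : (lebesgue_tuple R n).-integrable setT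
    (fun z => (marginal q e z * h z)%:E).
  under eq_fun do rewrite mulrBr mulr1 EFinB.
  apply: integrableB => //; last exact: integrable_density.
  apply: le_integrable (integrable_density _ _ _ pd) => //.
    apply/measurable_EFinP; apply: measurable_funM => //.
    by apply: measurable_funM => //; exact: measurable_funV.
  move=> z _; rewrite /= lee_fin ger0_norm ?mulr_ge0 ?invr_ge0//.
  by rewrite ger0_norm.
have hfin := expect_finite_latent R k m n q e h qd ed mh ih.
(* E h is at most the integral of p - r, and both densities have mass 1. *)
have h_le0 : expect q e (fun _ _ z => (h z)%:E) <= 0.
  rewrite expect_latent//.
  apply: (@le_trans _ _ (\int[lebesgue_tuple R n]_z
      ((p z)%:E - (marginal q e z)%:E))).
    apply: le_integral => //.
      by apply: integrableB => //; exact: integrable_density.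
    by move=> z _; rewrite -EFinB lee_fin mulrBr mulr1 lerB.
  by rewrite integralB//; [rewrite p1 M1 subee|exact: integrable_density..].
apply: (@le_trans _ _ (vae_objective q e g (marginal q e) -
    expect q e (fun _ _ z => (h z)%:E))).
  by rewrite leeDl// oppe_ge0.
rewrite /vae_objective -expectB//; apply: lee_sum => d _.
apply: ae_le_integral_of_integrable.
- exact: integrableB.
- exact: measurable_vae_integrand.
apply: filterS (joint_gt0_marginal_ae R k m n q e d qd ed) => xz.
rewrite !expect_integrand_neg_log_ratioE /expect_integrand.
  move: xz.1 xz.2 => x z Mgt0.
have [->|j0] := eqVneq (joint q e d x z) 0%R; first by rewrite !mul0e sube0.
have jgt0 : (0 < joint q e d x z)%R by rewrite lt_neqAle eq_sym j0 joint_ge0.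
apply: mule_oppe_lne_le => //; last exact: Mgt0.
by rewrite divr_ge0//; [case: gd => _ /(_ d z)[]|case: ed => _ /(_ d x)[]].
Qed.

(** * Minima and the decomposition *)

Lemma emin_attained (R : realType) (T : Type) (D : set T) (f : T -> \bar R)
    (t : T) : D t -> (forall s, D s -> f t <= f s) -> emin D f = f t.
Proof.
move=> Dt ft; apply/eqP; rewrite eq_le; apply/andP; split.
  by apply: ereal_inf_lbound; exists t.
by apply: le_ereal_inf_tmp => _ [s Ds <-]; exact: ft.
Qed.

Lemma eq_emin (R : realType) (T : Type) (D : set T) (f f' : T -> \bar R) :
  (forall t, D t -> f t = f' t) -> emin D f = emin D f'.
Proof. by move=> ff'; rewrite /emin (eq_imagel ff'). Qed.

Lemma eq_attains_min (R : realType) (T : Type) (D : set T)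
    (f f' : T -> \bar R) :
  (forall t, D t -> f t = f' t) -> attains_min D f -> attains_min D f'.
Proof.
move=> ff' [t Dt ft]; exists t => // s Ds; rewrite -!ff'//; exact: ft.
Qed.

Theorem proposition5 (R : realType) (k m n : nat)
    (q : 'I_k -> m.-tuple R -> R)
    (Enc : set (cond_fun R k m n)) (Dec : set (cond_fun R k n m))
    (q_density : is_data_density q)
    (Enc_density : forall e, Enc e -> is_cond_density e)
    (Dec_density : forall g, Dec g -> is_cond_density g)
    (fair_finite : forall e g, Enc e -> Dec g ->
       expect_finite q e (neg_log_ratio e g (@std_normal_pdf R n)))
    (KL_fin : forall e, Enc e ->
       KL_finite (marginal q e) (@std_normal_pdf R n))
    (fair_min_dec : forall e, Enc e ->
       attains_min Dec (fun g => vae_objective q e g (@std_normal_pdf R n)))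
    (fair_min_enc :
       attains_min Enc (fun e =>
         emin Dec (fun g => vae_objective q e g (@std_normal_pdf R n)))) :
  [/\ forall e g, Enc e -> Dec g ->
        attains_min [set p | is_density p] (vae_objective q e g),
      forall e, Enc e ->
        attains_min Dec (fun g =>
          emin [set p | is_density p] (vae_objective q e g)),
      attains_min Enc (fun e =>
        emin Dec (fun g => emin [set p | is_density p] (vae_objective q e g))
        + KL (marginal q e) (@std_normal_pdf R n)) &
      emin Enc (fun e =>
        emin Dec (fun g => vae_objective q e g (@std_normal_pdf R n))) =
      emin Enc (fun e =>
        emin Dec (fun g => emin [set p | is_density p] (vae_objective q e g))
        + KL (marginal q e) (@std_normal_pdf R n))].
Proof.
(* Finiteness of the KL term is what lets it be subtracted and added back in [\bar R]. *)
have KL_num e : Enc e -> KL (marginal q e) (@std_normal_pdf R n) \is a fin_num.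
  by move=> /KL_fin; exact: integrable_fin_num.
have margE e g : Enc e -> Dec g ->
    expect_finite q e (neg_log_ratio e g (marginal q e)) /\
    vae_objective q e g (marginal q e) =
      vae_objective q e g (@std_normal_pdf R n) -
      KL (marginal q e) (@std_normal_pdf R n).
  move=> Ee Dg; apply: vae_objective_marginal => //.
  - exact: Enc_density.
  - exact: Dec_density.
  - exact: measurable_std_normal_pdf.
  - exact: std_normal_pdf_gt0.
  - exact: KL_fin.
  - exact: fair_finite.
have marg_min e g : Enc e -> Dec g -> forall p, is_density p ->
    vae_objective q e g (marginal q e) <= vae_objective q e g p.
  move=> Ee Dg p pd; apply: vae_objective_ge_marginal => //.
  - exact: Enc_density.
  - exact: Dec_density.
  - by have [] := margE e g Ee Dg.
have marg_den e : Enc e -> is_density (marginal q e).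
  by move=> /Enc_density; exact: marginal_density.
have eminE e g : Enc e -> Dec g ->
    vae_objective q e g (@std_normal_pdf R n) -
      KL (marginal q e) (@std_normal_pdf R n) =
    emin [set p | is_density p] (vae_objective q e g).
  move=> Ee Dg; have [_ <-] := margE e g Ee Dg; apply/esym.
  by apply: emin_attained; [exact: marg_den|exact: marg_min].
have dec_min e : Enc e -> attains_min Dec (fun g =>
    emin [set p | is_density p] (vae_objective q e g)).
  move=> Ee; have [g Dg gmin] := fair_min_dec e Ee.
  (* The inner minimum is the fair objective shifted by a term constant in the decoder, so a fair
     minimizer [g] serves here too. *)
  apply: (eq_attains_min _ _ _ _ _ (fun g => eminE e g Ee)).
  by exists g => // g' Dg'; apply: leeB => //; exact: gmin.
have encE e : Enc e ->
    emin Dec (fun g => vae_objective q e g (@std_normal_pdf R n)) =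
    emin Dec (fun g => emin [set p | is_density p] (vae_objective q e g))
      + KL (marginal q e) (@std_normal_pdf R n).
  move=> Ee; have [g Dg gmin] := fair_min_dec e Ee.
  rewrite -(eq_emin _ _ _ _ _ (fun g => eminE e g Ee)).
  (* Both minima over decoders are evaluated at the same [g], after which the KL terms cancel. *)
  rewrite (emin_attained _ _ _ _ g Dg gmin) (emin_attained _ _ _ _ g)//.
    by rewrite subeK// KL_num.
  by move=> g' Dg'; apply: leeB => //; exact: gmin.
split => //.
- by move=> e g Ee Dg; exists (marginal q e); [exact: marg_den|exact: marg_min].
- exact: eq_attains_min encE fair_min_enc.
- exact: eq_emin.
Qed.
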